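(* $\mathrm{ACA}_0$ does not imply weak Martin's pointed tree theorem $\mathrm{wMPT}$; that is, $\mathrm{ACA}_0\not\vdash \mathrm{wMPT}$.
   Context: All theories are in the language of second order arithmetic, with models $(N,M,0,1,+,\times,<)$, where $N$ is the number sort and $M$ is the sort of sets of numbers (equivalently, up to coding, functions from numbers to numbers, called reals). $\mathrm{ACA}_0$ is the usual system of reverse mathematics including all arithmetical comprehension axioms. $\leq_{\rm T}$ denotes Turing reducibility. A tree $T\subseteq\omega^{<\omega}$ is a set of finite strings closed under initial segments; $[T]$ is the collection of its infinite paths. A perfect tree is a nonempty tree in which every node has two incompatible extensions in the tree. A set $A$ of reals is cofinal if for every real $x$ there is some $y\in A$ with $y\geq_{\rm T} x$. Weak Martin's pointed tree theorem, $\mathrm{wMPT}$, is the statement (formulated in second order arithmetic): for every tree $T\subseteq\omega^{<\omega}$, if $[T]$ is cofinal, then $T$ has a perfect subtree. *)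

(* Defs.v *)
From Stdlib Require Import List.

(** * The language of second order arithmetic

    Number variables and set variables are two independent families of
    de Bruijn indices.  As usual in second order arithmetic, equality is
    primitive for numbers only. *)

Inductive term : Type :=
| Var (x : nat)
| Zero
| One
| Plus (s t : term)
| Times (s t : term).

Inductive form : Type :=
| Bot
| Eq (s t : term)
| Lt (s t : term)
| Mem (t : term) (X : nat)
| Imp (p q : form)
| And (p q : form)
| Or (p q : form)
| All (p : form)
| Ex (p : form)
| SAll (p : form)
| SEx (p : form).

Definition Neg (p : form) : form := Imp p Bot.
Definition Iff (p q : form) : form := And (Imp p q) (Imp q p).

Fixpoint tsubst (f : nat -> term) (t : term) : term :=
  match t with
  | Var x => f x
  | Zero => Zero
  | One => One
  | Plus s t => Plus (tsubst f s) (tsubst f t)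
  | Times s t => Times (tsubst f s) (tsubst f t)
  end.

Definition shift (x : nat) : term := Var (S x).

Definition up (f : nat -> term) (x : nat) : term :=
  match x with
  | 0 => Var 0
  | S y => tsubst shift (f y)
  end.

Definition sup (g : nat -> nat) (X : nat) : nat :=
  match X with
  | 0 => 0
  | S Y => S (g Y)
  end.

(** Simultaneous capture-avoiding substitution of terms for the number
    variables and of set variables for the set variables. *)
Fixpoint subst (f : nat -> term) (g : nat -> nat) (p : form) : form :=
  match p with
  | Bot => Bot
  | Eq s t => Eq (tsubst f s) (tsubst f t)
  | Lt s t => Lt (tsubst f s) (tsubst f t)
  | Mem t X => Mem (tsubst f t) (g X)
  | Imp p q => Imp (subst f g p) (subst f g q)
  | And p q => And (subst f g p) (subst f g q)
  | Or p q => Or (subst f g p) (subst f g q)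
  | All p => All (subst (up f) g p)
  | Ex p => Ex (subst (up f) g p)
  | SAll p => SAll (subst f (sup g) p)
  | SEx p => SEx (subst f (sup g) p)
  end.

Definition lift (p : form) : form := subst shift (fun X => X) p.
Definition slift (p : form) : form := subst Var S p.

Definition inst (p : form) (t : term) : form :=
  subst (fun x => match x with 0 => t | S y => Var y end) (fun X => X) p.

Definition sinst (p : form) (Y : nat) : form :=
  subst Var (fun X => match X with 0 => Y | S Z => Z end) p.

(** * Classical two-sorted natural deduction from a set [T] of axioms

    The generalisation rules shift the context [G] but not [T], so an axiom
    with free variables has the force of its universal closure. *)

Inductive prv (T : form -> Prop) : list form -> form -> Prop :=
| Ax G p : T p -> prv T G p
| Hyp G p : In p G -> prv T G p
| RAA G p : prv T (Neg p :: G) Bot -> prv T G p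
| ImpI G p q : prv T (p :: G) q -> prv T G (Imp p q)
| ImpE G p q : prv T G (Imp p q) -> prv T G p -> prv T G q
| AndI G p q : prv T G p -> prv T G q -> prv T G (And p q)
| AndE1 G p q : prv T G (And p q) -> prv T G p
| AndE2 G p q : prv T G (And p q) -> prv T G q
| OrI1 G p q : prv T G p -> prv T G (Or p q)
| OrI2 G p q : prv T G q -> prv T G (Or p q)
| OrE G p q r :
    prv T G (Or p q) -> prv T (p :: G) r -> prv T (q :: G) r -> prv T G r
| AllI G p : prv T (map lift G) p -> prv T G (All p)
| AllE G p t : prv T G (All p) -> prv T G (inst p t)
| ExI G p t : prv T G (inst p t) -> prv T G (Ex p)
| ExE G p q :
    prv T G (Ex p) -> prv T (p :: map lift G) (lift q) -> prv T G q
| SAllI G p : prv T (map slift G) p -> prv T G (SAll p)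
| SAllE G p Y : prv T G (SAll p) -> prv T G (sinst p Y)
| SExI G p Y : prv T G (sinst p Y) -> prv T G (SEx p)
| SExE G p q :
    prv T G (SEx p) -> prv T (p :: map slift G) (slift q) -> prv T G q
| EqI G t : prv T G (Eq t t)
| EqE G p s t :
    prv T G (Eq s t) -> prv T G (inst p s) -> prv T G (inst p t).

Definition proves (T : form -> Prop) (p : form) : Prop := prv T nil p.

(** * Formulas with named bound variables

    To write concrete formulas without index arithmetic, a formula is
    presented as a function of the number of number quantifiers and the number
    of set quantifiers above it.  A variable bound at level [n] has index
    [n' - S n] when it occurs under [n'] quantifiers. *)

Definition dterm : Type := nat -> term.
Definition dset : Type := nat -> nat.
Definition dform : Type := nat -> nat -> form.

Definition close (p : dform) : form := p 0 0.

Definition dzero : dterm := fun _ => Zero.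
Definition done : dterm := fun _ => One.
Definition dplus (s t : dterm) : dterm := fun n => Plus (s n) (t n).
Definition dtimes (s t : dterm) : dterm := fun n => Times (s n) (t n).

Definition deq (s t : dterm) : dform := fun n _ => Eq (s n) (t n).
Definition dlt (s t : dterm) : dform := fun n _ => Lt (s n) (t n).
Definition dmem (t : dterm) (X : dset) : dform := fun n m => Mem (t n) (X m).
Definition dneg (p : dform) : dform := fun n m => Neg (p n m).
Definition dimp (p q : dform) : dform := fun n m => Imp (p n m) (q n m).
Definition dand (p q : dform) : dform := fun n m => And (p n m) (q n m).
Definition dor (p q : dform) : dform := fun n m => Or (p n m) (q n m).
Definition diff (p q : dform) : dform := fun n m => Iff (p n m) (q n m).
Definition dall (p : dterm -> dform) : dform :=
  fun n m => All (p (fun n' => Var (n' - S n)) (S n) m).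
Definition dex (p : dterm -> dform) : dform :=
  fun n m => Ex (p (fun n' => Var (n' - S n)) (S n) m).
Definition dsall (p : dset -> dform) : dform :=
  fun n m => SAll (p (fun m' => m' - S m) n (S m)).
Definition dsex (p : dset -> dform) : dform :=
  fun n m => SEx (p (fun m' => m' - S m) n (S m)).

Declare Scope soa_scope.
Delimit Scope soa_scope with soa.

Notation "0" := dzero : soa_scope.
Notation "1" := done : soa_scope.
Notation "2" := (dplus done done) : soa_scope.
Infix "+" := dplus : soa_scope.
Infix "*" := dtimes : soa_scope.
Infix "==" := deq (at level 70, no associativity) : soa_scope.
Infix "<" := dlt : soa_scope.
Infix "∈" := dmem (at level 70, no associativity) : soa_scope.
Notation "~ p" := (dneg p) : soa_scope.
Infix "/\" := dand : soa_scope.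
Infix "\/" := dor : soa_scope.
Infix "→" := dimp (at level 99, right associativity) : soa_scope.
Infix "↔" := diff (at level 95, no associativity) : soa_scope.
Notation "∀ x .. y , p" := (dall (fun x => .. (dall (fun y => p)) ..))
  (at level 200, x binder, y binder, right associativity) : soa_scope.
Notation "∃ x .. y , p" := (dex (fun x => .. (dex (fun y => p)) ..))
  (at level 200, x binder, y binder, right associativity) : soa_scope.
Notation "∀₂ X .. Y , p" := (dsall (fun X => .. (dsall (fun Y => p)) ..))
  (at level 200, X binder, Y binder, right associativity) : soa_scope.
Notation "∃₂ X .. Y , p" := (dsex (fun X => .. (dsex (fun Y => p)) ..))
  (at level 200, X binder, Y binder, right associativity) : soa_scope.

Local Open Scope soa_scope.

(** * The system ACA_0 *)

(** No set quantifiers; free set variables are allowed as parameters. *)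
Fixpoint arithmetical (p : form) : Prop :=
  match p with
  | Bot | Eq _ _ | Lt _ _ | Mem _ _ => True
  | Imp p q | And p q | Or p q => arithmetical p /\ arithmetical q
  | All p | Ex p => arithmetical p
  | SAll _ | SEx _ => False
  end.

(** [p] may contain any parameters; its number variable 0 is the element, and
    the lifting keeps the set being defined from occurring in [p]. *)
Definition comprehension (p : form) : form :=
  SEx (All (Iff (Mem (Var 0%nat) 0%nat) (slift p))).

Inductive ACA0 : form -> Prop :=
| succ_neq_zero : ACA0 (close (∀ n, ~ (n + 1 == 0)))
| succ_inj : ACA0 (close (∀ m n, m + 1 == n + 1 → m == n))
| plus_zero : ACA0 (close (∀ m, m + 0 == m))
| plus_succ : ACA0 (close (∀ m n, m + (n + 1) == (m + n) + 1))
| times_zero : ACA0 (close (∀ m, m * 0 == 0))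
| times_succ : ACA0 (close (∀ m n, m * (n + 1) == (m * n) + m))
| lt_zero : ACA0 (close (∀ m, ~ (m < 0)))
| lt_succ : ACA0 (close (∀ m n, m < n + 1 ↔ m < n \/ m == n))
| induction_axiom : ACA0 (close (∀₂ X,
    0 ∈ X /\ (∀ n, n ∈ X → n + 1 ∈ X) → ∀ n, n ∈ X))
| arithmetical_comprehension p :
    arithmetical p -> ACA0 (comprehension p).

(** * Coding of pairs and finite sequences *)

Definition pair (s t : dterm) : dterm := (s + t) * (s + t) + s.

(** Gödel's beta function: [v] is the remainder of [a] modulo
    [1 + (i + 1) * b]. *)
Definition beta (a b i v : dterm) : dform :=
  v < 1 + (i + 1) * b /\ ∃ q, a == q * (1 + (i + 1) * b) + v.

(** The number [pair l (pair a b)] stands for the sequence of length [l]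
    whose [i]-th entry is the value of the beta function at [a], [b], [i]. *)
Definition has_length (s l : dterm) : dform :=
  ∃ a b, s == pair l (pair a b).

Definition entry (s i v : dterm) : dform :=
  ∃ l a b, s == pair l (pair a b) /\ i < l /\ beta a b i v.

(** Elements of ω^{<ω} are the least numbers standing for a given sequence,
    so that every finite sequence has exactly one code. *)
Definition is_string (s : dterm) : dform :=
  ∃ l, has_length s l /\
    ∀ t, t < s /\ has_length t l →
      ~ (∀ i v, entry s i v ↔ entry t i v).

(** [s] is an initial segment of [t]. *)
Definition initial_segment (s t : dterm) : dform :=
  is_string s /\ is_string t /\ ∀ i v, entry s i v → entry t i v.

Definition incompatible (s t : dterm) : dform :=
  ~ initial_segment s t /\ ~ initial_segment t s.

(** * Trees and their paths *)

Definition tree (T : dset) : dform :=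
  (∀ s, s ∈ T → is_string s) /\
  (∀ s t, t ∈ T /\ initial_segment s t → s ∈ T).

Definition subtree (P T : dset) : dform :=
  tree P /\ ∀ s, s ∈ P → s ∈ T.

Definition perfect (P : dset) : dform :=
  tree P /\ (∃ s, s ∈ P) /\
  ∀ s, s ∈ P →
    ∃ t u, t ∈ P /\ u ∈ P /\ initial_segment s t /\ initial_segment s u /\
           incompatible t u.

(** [F] is (the graph of) a function from numbers to numbers, i.e. a real. *)
Definition real (F : dset) : dform :=
  (∀ p, p ∈ F → ∃ n m, p == pair n m) /\
  (∀ n, ∃ m, pair n m ∈ F) /\
  (∀ n m m', pair n m ∈ F /\ pair n m' ∈ F → m == m').

Definition path (F T : dset) : dform :=
  real F /\
  ∀ s, is_string s /\ (∀ i v, entry s i v → pair i v ∈ F) → s ∈ T.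

(** * Turing reducibility

    Oracle register machines.  A program [e] is a finite sequence of
    instructions [pair o (pair j q)], where [j] is a register and
      - [o = 0]: increment register [j] and go to the next instruction;
      - [o = 1]: if register [j] is zero jump to instruction [q], otherwise
                 decrement it and go to the next instruction;
      - [o = 2]: replace the content of register [j] by its image under the
                 oracle [Y] and go to the next instruction.
    A configuration is [pair p r] with [p] the instruction pointer and [r] the
    sequence of register contents.  The machine halts when [p] is outside the
    program.  Input and output are in register 0. *)

Definition step (e : dterm) (Y : dset) (c d : dterm) : dform :=
  ∃ p r p' r' j q v w,
    c == pair p r /\ d == pair p' r' /\
    entry r j v /\ entry r' j w /\
    (∀ i u, ~ (i == j) → (entry r i u ↔ entry r' i u)) /\
    ((entry e p (pair 0 (pair j q)) /\ w == v + 1 /\ p' == p + 1) \/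
     (entry e p (pair 1 (pair j q)) /\ v == 0 /\ w == 0 /\ p' == q) \/
     (entry e p (pair 1 (pair j q)) /\ v == w + 1 /\ p' == p + 1) \/
     (entry e p (pair 2 (pair j q)) /\ pair v w ∈ Y /\ p' == p + 1)).

Definition starts (n c : dterm) : dform :=
  ∃ r, c == pair 0 r /\ entry r 0 n /\ ∀ i v, entry r (i + 1) v → v == 0.

Definition halts (e m c : dterm) : dform :=
  ∃ p r, c == pair p r /\ ~ (∃ j, entry e p j) /\ entry r 0 m.

(** Program [e] with oracle [Y] and input [n] halts with output [m]; [h] is the
    sequence of configurations of the computation. *)
Definition computes (e : dterm) (Y : dset) (n m : dterm) : dform :=
  ∃ h k, has_length h (k + 1) /\
    (∃ c, entry h 0 c /\ starts n c) /\
    (∀ i c d, entry h i c /\ entry h (i + 1) d → step e Y c d) /\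
    (∃ c, entry h k c /\ halts e m c).

(** For reals [X] and [Y]. *)
Definition turing_reducible (X Y : dset) : dform :=
  ∃ e, ∀ n m, pair n m ∈ X → computes e Y n m.

(** * Weak Martin's pointed tree theorem *)

Definition paths_cofinal (T : dset) : dform :=
  ∀₂ X, real X → ∃₂ Y, path Y T /\ turing_reducible X Y.

Definition wMPT : form :=
  close (∀₂ T, tree T /\ paths_cofinal T →
           ∃₂ P, subtree P T /\ perfect P).

(* Main.v *)
(** Let the sets of an omega-model be the sets decided by functions built from
    countably many base functions by composition, pairing and least-number
    search; such a model satisfies ACA_0.  A function built in this way by a
    term [p], recorded together with the values of all subterms of [p], is the
    only infinite sequence satisfying local consistency conditions attached
    to [p]: the values of the search operator are its Skolem functions.
    Consider the tree of strings whose first entry codes some [p] and whose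
    remaining entries violate none of the conditions for [p].  A path is
    determined by its first entry, so two incompatible nodes above a nonempty
    node of a perfect subtree would lie on the same path; but every real of the
    model is an easily computed section of a path.  The tree belongs to the
    model because it is itself allowed as a base function: its definition on a
    string only refers to smaller strings. *)

From Stdlib Require Import Arith Lia List Cantor Factorial.
From Stdlib Require Import Relation_Operators Operators_Properties.
From Stdlib Require Import Classical ClassicalEpsilon FunctionalExtensionality.
From Stdlib Require Import PropExtensionality.
Require Import Defs.

(** * Semantics *)

Definition scons {A : Type} (a : A) (r : nat -> A) (n : nat) : A :=
  match n with 0 => a | S m => r m end.

Fixpoint teval (r : nat -> nat) (t : term) : nat :=
  match t with
  | Var x => r x
  | Zero => 0
  | One => 1
  | Plus s t => teval r s + teval r t
  | Times s t => teval r s * teval r t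
  end.

Fixpoint sat {D : Type} (mem : D -> nat -> Prop)
    (r : nat -> nat) (g : nat -> D) (p : form) : Prop :=
  match p with
  | Bot => False
  | Eq s t => teval r s = teval r t
  | Lt s t => teval r s < teval r t
  | Mem t X => mem (g X) (teval r t)
  | Imp p q => sat mem r g p -> sat mem r g q
  | And p q => sat mem r g p /\ sat mem r g q
  | Or p q => sat mem r g p \/ sat mem r g q
  | All p => forall n, sat mem (scons n r) g p
  | Ex p => exists n, sat mem (scons n r) g p
  | SAll p => forall X, sat mem r (scons X g) p
  | SEx p => exists X, sat mem r (scons X g) p
  end.

Lemma teval_subst r f t :
  teval r (tsubst f t) = teval (fun x => teval r (f x)) t.
Proof. induction t; simpl; congruence. Qed.

Lemma teval_up n r f :
  (fun x => teval (scons n r) (up f x)) = scons n (fun x => teval r (f x)).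
Proof.
  apply functional_extensionality; intros [|x]; simpl; auto.
  now rewrite teval_subst.
Qed.

Lemma scons_sup {D : Type} (X : D) g h :
  (fun Y => scons X g (sup h Y)) = scons X (fun Y => g (h Y)).
Proof. apply functional_extensionality; intros [|Y]; reflexivity. Qed.

Section Soundness.
Context {D : Type} (mem : D -> nat -> Prop).

Lemma sat_subst p : forall r g f h,
  sat mem r g (subst f h p) <->
  sat mem (fun x => teval r (f x)) (fun X => g (h X)) p.
Proof.
  induction p; intros r g f h; simpl; rewrite ?teval_subst;
    try reflexivity;
    try (rewrite IHp1, IHp2; reflexivity).
  - split; intros H n; specialize (H n); revert H; rewrite IHp, teval_up; auto.
  - split; intros [n H]; exists n; revert H; rewrite IHp, teval_up; auto.
  - split; intros H n; specialize (H n); revert H; rewrite IHp, scons_sup; auto.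
  - split; intros [n H]; exists n; revert H; rewrite IHp, scons_sup; auto.
Qed.

Lemma sat_lift n r g p : sat mem (scons n r) g (lift p) <-> sat mem r g p.
Proof. unfold lift. rewrite sat_subst. reflexivity. Qed.

Lemma sat_slift X r g p : sat mem r (scons X g) (slift p) <-> sat mem r g p.
Proof. unfold slift. rewrite sat_subst. reflexivity. Qed.

Lemma sat_inst r g p t :
  sat mem r g (inst p t) <-> sat mem (scons (teval r t) r) g p.
Proof.
  unfold inst. rewrite sat_subst.
  replace (fun x => teval r _) with (scons (teval r t) r); [reflexivity|].
  apply functional_extensionality; intros [|x]; reflexivity.
Qed.

Lemma sat_sinst r g p Y :
  sat mem r g (sinst p Y) <-> sat mem r (scons (g Y) g) p.
Proof.
  unfold sinst. rewrite sat_subst.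
  replace (fun X => g _) with (scons (g Y) g); [reflexivity|].
  apply functional_extensionality; intros [|x]; reflexivity.
Qed.

(** The axioms are taken to hold under every assignment, because [AllI] and [SAllI] shift the
    context but leave [T] alone. *)
Theorem soundness T (HT : forall p, T p -> forall r g, sat mem r g p) G p :
  prv T G p -> forall r g, (forall q, In q G -> sat mem r g q) -> sat mem r g p.
Proof.
  assert (lifts : forall G n r g, (forall q, In q G -> sat mem r g q) ->
    forall q, In q (map lift G) -> sat mem (scons n r) g q).
  { intros G' n r g H q Hq. apply in_map_iff in Hq as [q' [<- Hq]].
    apply sat_lift; auto. }
  assert (slifts : forall G X r g, (forall q, In q G -> sat mem r g q) ->
    forall q, In q (map slift G) -> sat mem r (scons X g) q).
  { intros G' n r g H q Hq. apply in_map_iff in Hq as [q' [<- Hq]].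
    apply sat_slift; auto. }
  assert (conss : forall G r g p, (forall q, In q G -> sat mem r g q) ->
    sat mem r g p -> forall q, In q (p :: G) -> sat mem r g q).
  { intros G' r g p' H Hp q [<-|Hq]; auto. }
  induction 1; intros v g HG; simpl in *.
  - auto.
  - auto.
  - apply NNPP; intro Hn. apply (IHprv v g). apply conss; auto.
  - intro Hp. apply IHprv, conss; auto.
  - apply IHprv1; auto.
  - auto.
  - apply (IHprv v g); auto.
  - apply (IHprv v g); auto.
  - auto.
  - auto.
  - destruct (IHprv1 v g HG); [apply IHprv2|apply IHprv3]; apply conss; auto.
  - intro n. apply IHprv, lifts, HG.
  - apply sat_inst, (IHprv v g HG).
  - exists (teval v t). apply sat_inst, IHprv, HG.
  - destruct (IHprv1 v g HG) as [n Hn]. apply (proj1 (sat_lift n v g q)).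
    apply IHprv2, conss; [apply lifts, HG | exact Hn].
  - intro X. apply IHprv, slifts, HG.
  - apply sat_sinst, (IHprv v g HG).
  - exists (g Y). apply sat_sinst, IHprv, HG.
  - destruct (IHprv1 v g HG) as [X HX]. apply (proj1 (sat_slift X v g q)).
    apply IHprv2, conss; [apply slifts, HG | exact HX].
  - reflexivity.
  - apply sat_inst. rewrite <- (IHprv1 v g HG). apply sat_inst, IHprv2, HG.
Qed.

End Soundness.

(** The formulas composing [wMPT], read in an omega-model; they repeat the
    syntactic definitions literally, so that [sat_wMPT] holds by computation. *)
Definition pr s t := (s + t) * (s + t) + s.

Definition Beta a b i v :=
  v < 1 + (i + 1) * b /\ exists q, a = q * (1 + (i + 1) * b) + v.

Definition HasLength s l := exists a b, s = pr l (pr a b).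

Definition Entry s i v :=
  exists l a b, s = pr l (pr a b) /\ i < l /\ Beta a b i v.

Definition IsString s :=
  exists l, HasLength s l /\
    forall t, t < s /\ HasLength t l ->
      ~ (forall i v, Entry s i v <-> Entry t i v).

Definition InitSeg s t :=
  IsString s /\ IsString t /\ forall i v, Entry s i v -> Entry t i v.

Definition Incompatible s t := ~ InitSeg s t /\ ~ InitSeg t s.

Definition Tree (T : nat -> Prop) :=
  (forall s, T s -> IsString s) /\
  (forall s t, T t /\ InitSeg s t -> T s).

Definition Subtree (P T : nat -> Prop) :=
  Tree P /\ forall s, P s -> T s.

Definition Perfect (P : nat -> Prop) :=
  Tree P /\ (exists s, P s) /\
  forall s, P s ->
    exists t u, P t /\ P u /\ InitSeg s t /\ InitSeg s u /\ Incompatible t u.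

Definition Real (F : nat -> Prop) :=
  (forall p, F p -> exists n m, p = pr n m) /\
  (forall n, exists m, F (pr n m)) /\
  (forall n m m', F (pr n m) /\ F (pr n m') -> m = m').

Definition Path (F T : nat -> Prop) :=
  Real F /\
  forall s, IsString s /\ (forall i v, Entry s i v -> F (pr i v)) -> T s.

Definition Step e (Y : nat -> Prop) c d :=
  exists p r p' r' j q v w,
    c = pr p r /\ d = pr p' r' /\
    Entry r j v /\ Entry r' j w /\
    (forall i u, ~ (i = j) -> (Entry r i u <-> Entry r' i u)) /\
    ((Entry e p (pr 0 (pr j q)) /\ w = v + 1 /\ p' = p + 1) \/
     ((Entry e p (pr 1 (pr j q)) /\ v = 0 /\ w = 0 /\ p' = q) \/
     ((Entry e p (pr 1 (pr j q)) /\ v = w + 1 /\ p' = p + 1) \/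
     (Entry e p (pr 2 (pr j q)) /\ Y (pr v w) /\ p' = p + 1)))).

Definition Starts n c :=
  exists r, c = pr 0 r /\ Entry r 0 n /\ forall i v, Entry r (i + 1) v -> v = 0.

Definition Halts e m c :=
  exists p r, c = pr p r /\ ~ (exists j, Entry e p j) /\ Entry r 0 m.

Definition Computes e (Y : nat -> Prop) n m :=
  exists h k, HasLength h (k + 1) /\
    (exists c, Entry h 0 c /\ Starts n c) /\
    (forall i c d, Entry h i c /\ Entry h (i + 1) d -> Step e Y c d) /\
    (exists c, Entry h k c /\ Halts e m c).

Definition TuringReducible (X Y : nat -> Prop) :=
  exists e, forall n m, X (pr n m) -> Computes e Y n m.

Lemma sat_wMPT {D : Type} (mem : D -> nat -> Prop) r g :
  sat mem r g wMPT =
  (forall T, Tree (mem T) /\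
     (forall X, Real (mem X) ->
        exists Y, Path (mem Y) (mem T) /\ TuringReducible (mem X) (mem Y)) ->
     exists P, Subtree (mem P) (mem T) /\ Perfect (mem P)).
Proof. reflexivity. Qed.

(** * Coded sequences *)

(** The value lies between the square of [s + t] and the next square, so it determines [s + t], and
    then [s]. *)
Lemma pr_inj s t s' t' : pr s t = pr s' t' -> s = s' /\ t = t'.
Proof.
  unfold pr; intro H.
  assert (s + t = s' + t') by nia.
  assert (s = s') by nia. lia.
Qed.

(** * Chinese remaindering and the beta function *)

Lemma gcd_mul_1 a b c : Nat.gcd a c = 1 -> Nat.gcd b c = 1 -> Nat.gcd (a * b) c = 1.
Proof.
  intros Ha Hb. apply Nat.divide_1_r. rewrite <- Hb.
  assert (Hl := Nat.gcd_divide_l (a * b) c).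
  assert (Hr := Nat.gcd_divide_r (a * b) c).
  apply Nat.gcd_greatest; [|exact Hr].
  apply Nat.gauss with a; [exact Hl|].
  apply Nat.divide_1_r. rewrite <- Ha. apply Nat.gcd_greatest.
  - apply Nat.gcd_divide_r.
  - etransitivity; [apply Nat.gcd_divide_l | exact Hr].
Qed.

Lemma divide_fact n d : 0 < d <= n -> Nat.divide d (fact n).
Proof.
  induction n as [|n IH]; intros H; [lia|]. simpl fact.
  change (Nat.divide d (S n * fact n)).
  destruct (Nat.eq_dec d (S n)) as [->|Hd].
  - apply Nat.divide_factor_l.
  - apply Nat.divide_mul_r, IH. lia.
Qed.

(** A common divisor divides the difference [b * (j - i)] and is coprime to [b]. Hence it divides
    [j - i], which is below [l] and so divides [b]; being coprime to [b], it is 1. *)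
Lemma beta_moduli_coprime b i j l :
  (forall d, 0 < d <= l -> Nat.divide d b) -> i < j < l ->
  Nat.gcd (1 + (i + 1) * b) (1 + (j + 1) * b) = 1.
Proof.
  intros Hb Hij. set (d := Nat.gcd _ _).
  assert (Hi : Nat.divide d (1 + (i + 1) * b)) by apply Nat.gcd_divide_l.
  assert (Hj : Nat.divide d (1 + (j + 1) * b)) by apply Nat.gcd_divide_r.
  assert (forall e, Nat.divide e d -> Nat.divide e b -> e = 1) as Hdb.
  { intros e Hed Heb. apply Nat.divide_1_r.
    apply Nat.divide_add_cancel_r with ((i + 1) * b).
    - now apply Nat.divide_mul_r.
    - rewrite Nat.add_comm. exact (Nat.divide_trans _ _ _ Hed Hi). }
  assert (Hd : Nat.divide d (b * (j - i))).
  { apply Nat.divide_add_cancel_r with (1 + (i + 1) * b); [exact Hi|].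
    replace (1 + (i + 1) * b + b * (j - i)) with (1 + (j + 1) * b) by nia.
    exact Hj. }
  apply Nat.gauss in Hd.
  - apply Hdb; [reflexivity|]. etransitivity; [exact Hd|]. apply Hb. lia.
  - apply Hdb; [apply Nat.gcd_divide_l | apply Nat.gcd_divide_r].
Qed.

Lemma chinese_remainder (m f : nat -> nat) l :
  (forall i, 0 < m i) ->
  (forall i j, i < j < l -> Nat.gcd (m i) (m j) = 1) ->
  exists a, forall i, i < l -> exists q, a = q * m i + f i.
Proof.
  intros Hm Hc.
  (* [M] acts as the product of the first [k] moduli. *)
  assert (H : forall k, k <= l -> exists a M, 0 < M /\
    (forall i, i < k -> Nat.divide (m i) M) /\
    (forall j, k <= j < l -> Nat.gcd M (m j) = 1) /\
    forall i, i < k -> exists q, a = q * m i + f i).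
  { induction k as [|k IH]; intro Hk.
    - exists 0, 1. repeat split; intros; try lia.
    - destruct IH as (a & M & HM & Hdiv & Hcop & Ha); [lia|].
      destruct (Nat.gcd_bezout_pos M (m k) HM) as (u & v & Huv).
      rewrite Hcop in Huv by lia.
      (* By Bezout [u * M] is 0 modulo the earlier moduli and 1 modulo [m k]. The summand
         [a * (m k - 1)] replaces [- a] in the natural numbers, so the new number is [f k] modulo
         [m k]. *)
      exists (a + u * M * (f k + a * (m k - 1))), (M * m k).
      assert (Hmk := Hm k).
      split; [nia|split; [|split]].
      + intros i Hi. destruct (Nat.eq_dec i k) as [->|].
        * apply Nat.divide_factor_r.
        * apply Nat.divide_mul_l, Hdiv. lia.
      + intros j Hj. apply gcd_mul_1; [apply Hcop|apply Hc]; lia.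
      + intros i Hi. destruct (Nat.eq_dec i k) as [->|].
        * exists (a + v * (f k + a * (m k - 1))). rewrite Huv.
          destruct (m k) as [|w]; [lia|].
          replace (S w - 1) with w by lia. ring.
        * destruct (Ha i) as [q Hq]; [lia|].
          destruct (Hdiv i) as [z Hz]; [lia|].
          exists (q + u * z * (f k + a * (m k - 1))).
          rewrite Hz, Hq at 1. ring. }
  destruct (H l) as (a & _ & _ & _ & _ & Ha); [lia|]. now exists a.
Qed.

Lemma bounded_prefix (f : nat -> nat) l : exists B, forall i, i < l -> f i <= B.
Proof.
  induction l as [|l [B HB]]; [exists 0; lia|].
  exists (B + f l). intros i Hi. destruct (Nat.eq_dec i l) as [->|]; [lia|].
  specialize (HB i). lia.
Qed.

Lemma le_fact n : n <= fact n.
Proof.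
  induction n as [|n IH]; simpl; [lia|]. assert (H := lt_O_fact n). nia.
Qed.

Lemma beta_exists (f : nat -> nat) l :
  exists a b, forall i, i < l -> Beta a b i (f i).
Proof.
  destruct (bounded_prefix f l) as [B HB].
  (* The factorial is divisible by all [d <= l], which makes the moduli coprime, and is at least
     [B], which makes every value smaller than its modulus. *)
  set (b := fact (B + l)).
  destruct (chinese_remainder (fun i => 1 + (i + 1) * b) f l) as [a Ha].
  - intro i; lia.
  - intros i j Hij. apply beta_moduli_coprime with l; [|exact Hij].
    intros d Hd. apply divide_fact. lia.
  - exists a, b. intros i Hi. split; [|now apply Ha].
    specialize (HB i Hi). assert (Hb := le_fact (B + l)). fold b in Hb. nia.
Qed.

Lemma Beta_fun a b i v w : Beta a b i v -> Beta a b i w -> v = w.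
Proof.
  intros [Hv [q Hq]] [Hw [q' Hq']].
  apply (Nat.div_mod_unique (1 + (i + 1) * b) q q' v w); lia.
Qed.

Lemma Entry_fun s i v w : Entry s i v -> Entry s i w -> v = w.
Proof.
  intros (l & a & b & -> & _ & H) (l' & a' & b' & He & _ & H').
  apply pr_inj in He as [_ He]. apply pr_inj in He as [<- <-].
  eapply Beta_fun; eauto.
Qed.

Lemma Entry_lt s i v : Entry s i v -> i < s.
Proof. intros (l & a & b & -> & Hi & _). unfold pr at 1. nia. Qed.

Lemma Entry_total s l i : HasLength s l -> i < l -> exists v, Entry s i v.
Proof.
  intros (a & b & ->) Hi.
  exists (a mod (1 + (i + 1) * b)), l, a, b. repeat split; auto.
  - apply Nat.mod_upper_bound; lia.
  - exists (a / (1 + (i + 1) * b)).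
    rewrite (Nat.div_mod_eq a (1 + (i + 1) * b)) at 1. ring.
Qed.

Lemma Entry_length s l i v : HasLength s l -> Entry s i v -> i < l.
Proof.
  intros (a & b & ->) (l' & a' & b' & He & Hi & _).
  now apply pr_inj in He as [-> _].
Qed.

(** No minimality as in [IsString] is demanded: these codes serve for programs, register contents
    and histories, not for nodes of trees. *)
Definition Codes s l (f : nat -> nat) :=
  HasLength s l /\ forall i v, Entry s i v <-> i < l /\ v = f i.

Lemma Codes_exists l f : exists s, Codes s l f.
Proof.
  destruct (beta_exists f l) as (a & b & H).
  exists (pr l (pr a b)). split; [now exists a, b|].
  assert (He : forall i, i < l -> Entry (pr l (pr a b)) i (f i)).
  { intros i Hi. exists l, a, b. auto. }
  intros i v; split.
  - intro Hv. assert (Hi : i < l).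
    { eapply Entry_length; [|exact Hv]. now exists a, b. }
    split; [exact Hi|]. eapply Entry_fun; eauto.
  - intros [Hi ->]; auto.
Qed.

(** * Terms and their Skolemised evaluations *)

(** A second pairing besides [pr]; this one is a bijection with the natural numbers. *)
Definition cp x y := Cantor.to_nat (x, y).
Definition hd z := fst (Cantor.of_nat z).
Definition tl z := snd (Cantor.of_nat z).

Lemma hd_cp x y : hd (cp x y) = x.
Proof. unfold hd, cp. now rewrite Cantor.cancel_of_to. Qed.

Lemma tl_cp x y : tl (cp x y) = y.
Proof. unfold tl, cp. now rewrite Cantor.cancel_of_to. Qed.

Lemma cp_inj x y x' y' : cp x y = cp x' y' -> x = x' /\ y = y'.
Proof.
  intro H. split.
  - now rewrite <- (hd_cp x y), H, hd_cp.
  - now rewrite <- (tl_cp x y), H, tl_cp.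
Qed.

(** [FTree] is to denote the characteristic function of the tree itself. *)
Inductive fn : Type :=
| FConst (n : nat) | FFst | FSnd | FPlus | FTimes | FEq | FLt | FPr
| FPred | FThird | FRem | FCase | FTree.

Inductive code : Type :=
| CFn (f : fn)
| CComp (p q : code)
| CPair (p q : code)
| CMu (p : code).

Definition chi (P : Prop) : nat := if excluded_middle_informative P then 1 else 0.

Lemma chi_spec P : chi P <> 0 <-> P.
Proof. unfold chi. destruct excluded_middle_informative; split; intro H;
  [assumption | discriminate | now contradict H | contradiction].
Qed.

Lemma chi_iff P Q : (P <-> Q) -> chi P = chi Q.
Proof.
  unfold chi. intro H.
  do 2 destruct excluded_middle_informative; tauto.
Qed.

(** [0] reports a failed search and [S y] the least solution [y]. *)
Definition is_mu (f : nat -> nat) (v : nat) : Prop :=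
  match v with
  | 0 => forall y, f y = 0
  | S y => f y <> 0 /\ forall y', y' < y -> f y' = 0
  end.

Definition mu (f : nat -> nat) : nat := epsilon (inhabits 0) (is_mu f).

Lemma mu_spec f : is_mu f (mu f).
Proof.
  unfold mu. apply epsilon_spec.
  destruct (classic (forall y, f y = 0)) as [H|H]; [now exists 0|].
  apply not_all_ex_not in H as [y Hy].
  induction y as [y IH] using lt_wf_ind.
  destruct (classic (forall y', y' < y -> f y' = 0)) as [H|H].
  - exists (S y). now split.
  - apply not_all_ex_not in H as [y' H]. apply imply_to_and in H as [Hlt H].
    now apply (IH y').
Qed.

Lemma is_mu_unique f v w : is_mu f v -> is_mu f w -> v = w.
Proof.
  destruct v as [|v], w as [|w]; simpl; auto.
  - intros H [H' _]. now specialize (H w).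
  - intros [H' _] H. now specialize (H v).
  - intros [Hv Hv'] [Hw Hw'].
    destruct (Nat.lt_trichotomy v w) as [H|[->|H]]; auto.
    + now specialize (Hw' _ H).
    + now specialize (Hv' _ H).
Qed.

Definition case (n a b : nat) : nat := match n with 0 => a | _ => b end.

Definition fnval (A : nat -> Prop) (f : fn) (x : nat) : nat :=
  match f with
  | FConst n => n
  | FFst => hd x
  | FSnd => tl x
  | FPlus => hd x + tl x
  | FTimes => hd x * tl x
  | FEq => if hd x =? tl x then 1 else 0
  | FLt => if hd x <? tl x then 1 else 0
  | FPr => pr (hd x) (tl x)
  | FPred => pred x
  | FThird => x / 3
  | FRem => x mod 3
  | FCase => case (hd x) (hd (tl x)) (tl (tl x))
  | FTree => chi (A x)
  end.

Fixpoint val (A : nat -> Prop) (p : code) (x : nat) : nat :=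
  match p with
  | CFn f => fnval A f x
  | CComp p q => val A p (val A q x)
  | CPair p q => cp (val A p x) (val A q x)
  | CMu p => mu (fun y => val A p (cp y x))
  end.

(** The values of [p] are at the multiples of [3], the traces of its immediate
    subterms at the other two residues. *)
Fixpoint trace (A : nat -> Prop) (p : code) (i : nat) : nat :=
  match p with
  | CFn f => fnval A f (i / 3)
  | CComp q r | CPair q r =>
      case (i mod 3) (val A p (i / 3))
        (case (pred (i mod 3)) (trace A q (i / 3)) (trace A r (i / 3)))
  | CMu q => case (i mod 3) (val A p (i / 3)) (trace A q (i / 3))
  end.

Definition rel := nat -> nat -> Prop.

(** [E] is the graph of a partial approximation to [trace A p]. *)
Fixpoint consistent (A : nat -> Prop) (p : code) (E : rel) : Prop :=
  match p with
  | CFn f => forall i v, E i v -> v = fnval A f (i / 3)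
  | CComp q r =>
      consistent A q (fun i => E (3 * i + 1)) /\
      consistent A r (fun i => E (3 * i + 2)) /\
      forall x v y z, E (3 * x) v -> E (3 * (3 * x) + 2) y ->
        E (3 * (3 * y) + 1) z -> v = z
  | CPair q r =>
      consistent A q (fun i => E (3 * i + 1)) /\
      consistent A r (fun i => E (3 * i + 2)) /\
      forall x v y z, E (3 * x) v -> E (3 * (3 * x) + 1) y ->
        E (3 * (3 * x) + 2) z -> v = cp y z
  | CMu q =>
      consistent A q (fun i => E (3 * i + 1)) /\
      consistent A q (fun i => E (3 * i + 2)) /\
      forall x v, E (3 * x) v ->
        match v with
        | 0 => forall y z, E (3 * (3 * cp y x) + 1) z -> z = 0
        | S y => (forall z, E (3 * (3 * cp y x) + 1) z -> z <> 0) /\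
            forall y' z, y' < y -> E (3 * (3 * cp y' x) + 1) z -> z = 0
        end
  end.

Lemma div3 x k : k < 3 -> (3 * x + k) / 3 = x.
Proof. intro H. symmetry. apply Nat.div_unique with k; lia. Qed.

Lemma mod3 x k : k < 3 -> (3 * x + k) mod 3 = k.
Proof. intro H. symmetry. apply Nat.mod_unique with x; lia. Qed.

Lemma trace_0 A p x : trace A p (3 * x) = val A p x.
Proof.
  replace (3 * x) with (3 * x + 0) by lia.
  destruct p; cbn [trace]; rewrite ?div3, ?mod3 by lia; reflexivity.
Qed.

Lemma div3_cases i : exists x, i = 3 * x \/ i = 3 * x + 1 \/ i = 3 * x + 2.
Proof.
  exists (i / 3). assert (H := Nat.div_mod_eq i 3).
  assert (H' : i mod 3 < 3) by now apply Nat.mod_upper_bound. lia.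
Qed.

(** [E] occurs only as a hypothesis in the conditions, so removing entries removes obligations. This
    is what closes the tree under initial segments. *)
Lemma consistent_anti A p : forall E E' : rel,
  (forall i v, E' i v -> E i v) -> consistent A p E -> consistent A p E'.
Proof.
  induction p as [f|q IHq r IHr|q IHq r IHr|q IHq]; simpl; intros E E' H.
  - eauto.
  - intros (Hq & Hr & Hl). split; [|split]; [| |eauto].
    + revert Hq. apply IHq. auto.
    + revert Hr. apply IHr. auto.
  - intros (Hq & Hr & Hl). split; [|split]; [| |eauto].
    + revert Hq. apply IHq. auto.
    + revert Hr. apply IHr. auto.
  - intros (Hq & Hr & Hl). split; [|split].
    + revert Hq. apply IHq. auto.
    + revert Hr. apply IHq. auto.
    + intros x v Hv. specialize (Hl x v (H _ _ Hv)).
      destruct v; [eauto|]. destruct Hl; split; eauto.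
Qed.

(** Each instance of a condition mentions at most three entries, and by monotonicity they all occur
    in a single [En n]. A failed search is also checked one candidate [y] at a time. *)
Lemma consistent_union A p : forall En : nat -> rel,
  (forall m n i v, m <= n -> En m i v -> En n i v) ->
  (forall n, consistent A p (En n)) ->
  consistent A p (fun i v => exists n, En n i v).
Proof.
  induction p as [f|q IHq r IHr|q IHq r IHr|q IHq]; simpl; intros En Hm H.
  - intros i v [n Hn]. eapply H; eauto.
  - split; [|split].
    + apply (IHq (fun n i => En n (3 * i + 1))); [eauto|]. intro; apply H.
    + apply (IHr (fun n i => En n (3 * i + 2))); [eauto|]. intro; apply H.
    + intros x v y z [n1 H1] [n2 H2] [n3 H3].
      apply (H (n1 + n2 + n3)) with x y.
      * revert H1; apply Hm; lia.
      * revert H2; apply Hm; lia.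
      * revert H3; apply Hm; lia.
  - split; [|split].
    + apply (IHq (fun n i => En n (3 * i + 1))); [eauto|]. intro; apply H.
    + apply (IHr (fun n i => En n (3 * i + 2))); [eauto|]. intro; apply H.
    + intros x v y z [n1 H1] [n2 H2] [n3 H3].
      apply (H (n1 + n2 + n3)) with x.
      * revert H1; apply Hm; lia.
      * revert H2; apply Hm; lia.
      * revert H3; apply Hm; lia.
  - split; [|split].
    + apply (IHq (fun n i => En n (3 * i + 1))); [eauto|]. intro; apply H.
    + apply (IHq (fun n i => En n (3 * i + 2))); [eauto|]. intro; apply H.
    + intros x v [n1 H1].
      assert (Hl : forall n, En (n1 + n) (3 * x) v).
      { intro n. revert H1; apply Hm; lia. }
      assert (Hz : forall n i z, En n i z -> En (n1 + n) i z).
      { intros n i z. apply Hm. lia. }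
      destruct v as [|y].
      * intros y z [n2 H2].
        destruct (H (n1 + n2)) as (_ & _ & Hc).
        apply (Hc x 0 (Hl n2) y z). auto.
      * split.
        -- intros z [n2 H2]. destruct (H (n1 + n2)) as (_ & _ & Hc).
           apply (Hc x (S y) (Hl n2)). auto.
        -- intros y' z Hy [n2 H2]. destruct (H (n1 + n2)) as (_ & _ & Hc).
           apply (proj2 (Hc x (S y) (Hl n2)) y' z); auto.
Qed.

(** Induction on [p]: the entries at residues 1 and 2 are right by induction, totality supplies
    those that a condition refers to, and the condition then fixes the entry at residue 0. For [CMu]
    the condition becomes [is_mu], which has only one solution. *)
Lemma consistent_unique A p : forall E : rel,
  (forall i, exists v, E i v) -> consistent A p E ->
  forall i v, E i v -> v = trace A p i.
Proof.
  induction p as [f|q IHq r IHr|q IHq r IHr|q IHq]; intros E Ht H i v Hv.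
  - apply H, Hv.
  - destruct H as (Hq & Hr & Hl).
    specialize (IHq (fun i => E (3 * i + 1)) (fun i => Ht _) Hq).
    specialize (IHr (fun i => E (3 * i + 2)) (fun i => Ht _) Hr).
    cbv beta in IHq, IHr.
    destruct (div3_cases i) as [x [->|[->| ->]]].
    + rewrite trace_0.
      (* Here [y] is the recorded value of [r] at [x], and [z] that of [q] at [y]. *)
      destruct (Ht (3 * (3 * x) + 2)) as [y Hy].
      destruct (Ht (3 * (3 * y) + 1)) as [z Hz].
      rewrite (Hl x v y z); auto.
      apply IHr in Hy. apply IHq in Hz. rewrite trace_0 in *. now subst.
    + cbn [trace]. rewrite div3, mod3 by lia. now apply IHq.
    + cbn [trace]. rewrite div3, mod3 by lia. now apply IHr.
  - destruct H as (Hq & Hr & Hl).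
    specialize (IHq (fun i => E (3 * i + 1)) (fun i => Ht _) Hq).
    specialize (IHr (fun i => E (3 * i + 2)) (fun i => Ht _) Hr).
    cbv beta in IHq, IHr.
    destruct (div3_cases i) as [x [->|[->| ->]]].
    + rewrite trace_0.
      destruct (Ht (3 * (3 * x) + 1)) as [y Hy].
      destruct (Ht (3 * (3 * x) + 2)) as [z Hz].
      rewrite (Hl x v y z); auto.
      apply IHq in Hy. apply IHr in Hz. rewrite trace_0 in *. now subst.
    + cbn [trace]. rewrite div3, mod3 by lia. now apply IHq.
    + cbn [trace]. rewrite div3, mod3 by lia. now apply IHr.
  - destruct H as (Hq & Hr & Hl).
    (* For [CMu q] both nonzero residues carry the trace of [q]. *)
    assert (IHq' := IHq (fun i => E (3 * i + 2)) (fun i => Ht _) Hr).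
    specialize (IHq (fun i => E (3 * i + 1)) (fun i => Ht _) Hq).
    cbv beta in IHq, IHq'.
    destruct (div3_cases i) as [x [->|[->| ->]]].
    + rewrite trace_0. cbn [val]. specialize (Hl x v Hv).
      assert (Hval : forall y, E (3 * (3 * cp y x) + 1) (val A q (cp y x))).
      { intro y. destruct (Ht (3 * (3 * cp y x) + 1)) as [z Hz].
        rewrite <- trace_0, <- (IHq _ _ Hz). exact Hz. }
      eapply is_mu_unique; [|apply mu_spec].
      destruct v as [|y]; simpl.
      * intro y. apply (Hl y), Hval.
      * destruct Hl as [Hl Hl']. split; [apply Hl, Hval|].
        intros y' Hy. apply (Hl' y'), Hval. exact Hy.
    + cbn [trace]. rewrite div3, mod3 by lia. now apply IHq.
    + cbn [trace]. rewrite div3, mod3 by lia. now apply IHq'.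
Qed.

Lemma consistent_trace A p : consistent A p (fun i v => v = trace A p i).
Proof.
  assert (case1 : forall q E, (forall i, E i = trace A q i) ->
    consistent A q (fun i v => v = trace A q i) ->
    consistent A q (fun i v => v = E i)).
  { intros q E HE. apply consistent_anti. intros i v ->. apply HE. }
  induction p as [f|q IHq r IHr|q IHq r IHr|q IHq]; cbn [consistent].
  - auto.
  - split; [|split].
    + apply case1; auto. intro i. cbn [trace].
      now rewrite div3, mod3 by lia.
    + apply case1; auto. intro i. cbn [trace].
      now rewrite div3, mod3 by lia.
    + intros x v y z -> -> ->. rewrite trace_0. cbn [trace].
      now rewrite !div3, !mod3, !trace_0 by lia.
  - split; [|split].
    + apply case1; auto. intro i. cbn [trace].
      now rewrite div3, mod3 by lia.
    + apply case1; auto. intro i. cbn [trace].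
      now rewrite div3, mod3 by lia.
    + intros x v y z -> -> ->. rewrite trace_0. cbn [trace].
      now rewrite !div3, !mod3, !trace_0 by lia.
  - split; [|split].
    + apply case1; auto. intro i. cbn [trace].
      now rewrite div3, mod3 by lia.
    + apply case1; auto. intro i. cbn [trace].
      now rewrite div3, mod3 by lia.
    + intros x v ->. rewrite trace_0. cbn [val].
      assert (Hy : forall y, trace A (CMu q) (3 * (3 * cp y x) + 1) =
                             val A q (cp y x)).
      { intro y. cbn [trace]. now rewrite div3, mod3, trace_0 by lia. }
      assert (Hmu := mu_spec (fun y => val A q (cp y x))).
      destruct (mu _) as [|w].
      * intros y z ->. rewrite Hy. apply Hmu.
      * split.
        -- intros z ->. rewrite Hy. apply Hmu.
        -- intros y' z Hlt ->. rewrite Hy. now apply Hmu.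
Qed.

(** [A] is consulted only for [FTree], at a third of a position that carries an entry, and passing
    to the trace of a subterm only decreases positions. *)
Lemma consistent_local A A' s p : (forall x, x < s -> A x <-> A' x) ->
  forall E : rel, (forall i v, E i v -> i < s) ->
  consistent A p E -> consistent A' p E.
Proof.
  intro HA.
  induction p as [f|q IHq r IHr|q IHq r IHr|q IHq]; cbn [consistent]; intros E HE.
  - intros H i v Hv. rewrite (H _ _ Hv). destruct f; auto; cbn [fnval].
    apply chi_iff, HA. apply Nat.le_lt_trans with i; [|eauto].
    apply Nat.Div0.div_le_upper_bound. lia.
  - intros (Hq & Hr & Hl). split; [|split; [|exact Hl]].
    + apply IHq; auto. intros i v Hv. specialize (HE _ _ Hv). lia.
    + apply IHr; auto. intros i v Hv. specialize (HE _ _ Hv). lia.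
  - intros (Hq & Hr & Hl). split; [|split; [|exact Hl]].
    + apply IHq; auto. intros i v Hv. specialize (HE _ _ Hv). lia.
    + apply IHr; auto. intros i v Hv. specialize (HE _ _ Hv). lia.
  - intros (Hq & Hr & Hl). split; [|split; [|exact Hl]].
    + apply IHq; auto. intros i v Hv. specialize (HE _ _ Hv). lia.
    + apply IHq; auto. intros i v Hv. specialize (HE _ _ Hv). lia.
Qed.

(** * Coding of terms and the tree as a fixed point *)

Definition encfn (f : fn) : nat :=
  match f with
  | FConst n => 12 + n
  | FFst => 0 | FSnd => 1 | FPlus => 2 | FTimes => 3 | FEq => 4 | FLt => 5
  | FPr => 6 | FPred => 7 | FThird => 8 | FRem => 9 | FCase => 10 | FTree => 11
  end.

Lemma encfn_inj f g : encfn f = encfn g -> f = g.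
Proof. destruct f, g; simpl; intro H; congruence || discriminate. Qed.

Fixpoint enc (p : code) : nat :=
  match p with
  | CFn f => cp 0 (encfn f)
  | CComp p q => cp 1 (cp (enc p) (enc q))
  | CPair p q => cp 2 (cp (enc p) (enc q))
  | CMu p => cp 3 (enc p)
  end.

Lemma enc_inj p q : enc p = enc q -> p = q.
Proof.
  revert q.
  induction p; intros []; simpl; intro H; apply cp_inj in H as [Ht H];
    try discriminate.
  - f_equal. now apply encfn_inj.
  - apply cp_inj in H as [H1 H2]. f_equal; auto.
  - apply cp_inj in H as [H1 H2]. f_equal; auto.
  - f_equal; auto.
Qed.

(** The string without entries satisfies the second clause vacuously and is the root. The trace
    starts at entry 1, after the code of the term. *)
Definition treeop (A : nat -> Prop) (s : nat) : Prop :=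
  IsString s /\
  forall k, Entry s 0 k ->
    exists p, enc p = k /\ consistent A p (fun i => Entry s (S i)).

Lemma treeop_local A A' s :
  (forall x, x < s -> A x <-> A' x) -> treeop A s -> treeop A' s.
Proof.
  intros HA [Hs H]. split; auto. intros k Hk.
  destruct (H k Hk) as (p & Hp & Hc). exists p. split; auto.
  apply (consistent_local A A' s); auto.
  intros i v Hv. apply Entry_lt in Hv. lia.
Qed.

(** Whether [s] is in the tree depends on the tree only below [s], as entries
    of [s] sit at positions below [s]; hence [treeop] has a fixed point. *)
Fixpoint treeapprox (n : nat) : nat -> Prop :=
  match n with 0 => fun _ => False | S n => treeop (treeapprox n) end.

Definition skolem_tree (s : nat) : Prop := treeapprox (S s) s.

(** Both stages apply [treeop] to their predecessors, which by induction agree below [s]. *)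
Lemma treeapprox_agree s : forall m n, s < m -> s < n ->
  treeapprox m s -> treeapprox n s.
Proof.
  induction s as [s IH] using lt_wf_ind.
  intros [|m] [|n] Hm Hn; try lia. simpl.
  apply treeop_local. intros x Hx. split; apply IH; lia.
Qed.

Lemma skolem_tree_fixpoint s : skolem_tree s <-> treeop skolem_tree s.
Proof.
  unfold skolem_tree at 1. simpl.
  split; apply treeop_local; intros x Hx; split; apply treeapprox_agree; lia.
Qed.

Lemma skolem_tree_is_tree : Tree skolem_tree.
Proof.
  split.
  - intros s Hs. apply skolem_tree_fixpoint in Hs. apply Hs.
  - intros s t [Ht (Hs & _ & Hst)]. apply skolem_tree_fixpoint.
    apply skolem_tree_fixpoint in Ht as [_ Ht]. split; auto. intros k Hk.
    destruct (Ht k (Hst _ _ Hk)) as (p & Hp & Hc). exists p. split; auto.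
    revert Hc. apply consistent_anti. auto.
Qed.

(** * The model and its tree *)

Definition V : code -> nat -> nat := val skolem_tree.
(** The set sort of the model is [code] itself. Several terms may name one set, which is harmless
    since equality of sets is not primitive. *)
Definition mem (p : code) (x : nat) : Prop := V p x <> 0.

Definition definable (F : nat -> nat) : Prop := exists p, forall x, V p x = F x.

Lemma definable_ext F G : (forall x, F x = G x) -> definable F -> definable G.
Proof. intros H [p Hp]. exists p. intro x. now rewrite Hp. Qed.

Lemma definable_fn f : definable (fnval skolem_tree f).
Proof. now exists (CFn f). Qed.

Lemma definable_comp F G :
  definable F -> definable G -> definable (fun x => F (G x)).
Proof.
  intros [p Hp] [q Hq]. exists (CComp p q). intro x. cbn.
  fold V. now rewrite Hq, Hp.
Qed.

Lemma definable_cp F G :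
  definable F -> definable G -> definable (fun x => cp (F x) (G x)).
Proof.
  intros [p Hp] [q Hq]. exists (CPair p q). intro x. cbn.
  fold V. now rewrite Hq, Hp.
Qed.

Lemma definable_mu F :
  definable F -> definable (fun x => mu (fun y => F (cp y x))).
Proof.
  intros [p Hp]. exists (CMu p). intro x. cbn. f_equal.
  apply functional_extensionality. intro y. apply Hp.
Qed.

Lemma definable_op f F G : definable F -> definable G ->
  definable (fun x => fnval skolem_tree f (cp (F x) (G x))).
Proof.
  intros HF HG. apply (definable_comp (fnval skolem_tree f)).
  - apply definable_fn.
  - now apply definable_cp.
Qed.

Lemma definable_const n : definable (fun _ => n).
Proof. apply (definable_fn (FConst n)). Qed.

Lemma definable_hd : definable hd.
Proof. apply (definable_fn FFst). Qed.

Lemma definable_tl : definable tl.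
Proof. apply (definable_fn FSnd). Qed.

(** The identity is not a base function; it arises from the projections because [cp] is
    surjective. *)
Lemma definable_id : definable (fun x => x).
Proof.
  apply (definable_ext (fun x => cp (hd x) (tl x))).
  - intro x. unfold cp, hd, tl. rewrite <- surjective_pairing.
    apply Cantor.cancel_to_of.
  - apply definable_cp; [apply definable_hd | apply definable_tl].
Qed.

Lemma definable_V p : definable (V p).
Proof. now exists p. Qed.

Lemma definable_plus F G :
  definable F -> definable G -> definable (fun x => F x + G x).
Proof.
  intros HF HG. eapply definable_ext; [|exact (definable_op FPlus F G HF HG)].
  intro x. simpl. now rewrite hd_cp, tl_cp.
Qed.

Lemma definable_times F G :
  definable F -> definable G -> definable (fun x => F x * G x).
Proof.
  intros HF HG. eapply definable_ext; [|exact (definable_op FTimes F G HF HG)].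
  intro x. simpl. now rewrite hd_cp, tl_cp.
Qed.

Lemma definable_pr F G :
  definable F -> definable G -> definable (fun x => pr (F x) (G x)).
Proof.
  intros HF HG. eapply definable_ext; [|exact (definable_op FPr F G HF HG)].
  intro x. simpl. now rewrite hd_cp, tl_cp.
Qed.

Lemma definable_case F G H : definable F -> definable G -> definable H ->
  definable (fun x => case (F x) (G x) (H x)).
Proof.
  intros HF HG HH.
  eapply definable_ext;
    [|exact (definable_op FCase F _ HF (definable_cp G H HG HH))].
  intro x. simpl. now rewrite hd_cp, !tl_cp, hd_cp.
Qed.

Lemma definable_pred F : definable F -> definable (fun x => pred (F x)).
Proof. apply (definable_comp _ _ (definable_fn FPred)). Qed.

Lemma definable_third : definable (fun x => x / 3).
Proof. apply (definable_fn FThird). Qed.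

Lemma definable_rem : definable (fun x => x mod 3).
Proof. apply (definable_fn FRem). Qed.

(** Needed to have the path attached to [p] in the model. The recursion runs over the term, so a
    fixed trace unfolds into finitely many case distinctions on residues. *)
Lemma definable_trace p : definable (trace skolem_tree p).
Proof.
  assert (H3 : forall F, definable F -> definable (fun i => F (i / 3))).
  { intros F HF. apply (definable_comp F _ HF definable_third). }
  assert (Hr := definable_rem).
  induction p as [f|q IHq r IHr|q IHq r IHr|q IHq]; cbn [trace].
  - apply (H3 (fnval skolem_tree f)), definable_fn.
  - apply definable_case; [exact Hr|apply (H3 (V (CComp q r))), definable_V|].
    apply definable_case; [now apply definable_pred| |]; now apply H3.
  - apply definable_case; [exact Hr|apply (H3 (V (CPair q r))), definable_V|].
    apply definable_case; [now apply definable_pred| |]; now apply H3.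
  - apply definable_case; [exact Hr|apply (H3 (V (CMu q))), definable_V|].
    now apply H3.
Qed.

(** * Definable sets and arithmetical comprehension *)

Definition definable_set (P : nat -> Prop) : Prop :=
  exists p, forall x, mem p x <-> P x.

Lemma definable_set_ext P Q :
  (forall x, P x <-> Q x) -> definable_set P -> definable_set Q.
Proof. intros H [p Hp]. exists p. intro x. now rewrite Hp. Qed.

Lemma definable_set_nonzero F :
  definable F -> definable_set (fun x => F x <> 0).
Proof. intros [p Hp]. exists p. intro x. unfold mem. now rewrite Hp. Qed.

Lemma definable_set_preim P F :
  definable_set P -> definable F -> definable_set (fun x => P (F x)).
Proof.
  intros [p Hp] HF.
  eapply definable_set_ext;
    [|exact (definable_set_nonzero _ (definable_comp _ _ (definable_V p) HF))].
  intro x. apply Hp.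
Qed.

Lemma definable_set_eq F G :
  definable F -> definable G -> definable_set (fun x => F x = G x).
Proof.
  intros HF HG.
  eapply definable_set_ext;
    [|exact (definable_set_nonzero _ (definable_op FEq F G HF HG))].
  intro x. cbn [fnval]. rewrite hd_cp, tl_cp.
  destruct (Nat.eqb_spec (F x) (G x)); split; lia.
Qed.

Lemma definable_set_lt F G :
  definable F -> definable G -> definable_set (fun x => F x < G x).
Proof.
  intros HF HG.
  eapply definable_set_ext;
    [|exact (definable_set_nonzero _ (definable_op FLt F G HF HG))].
  intro x. cbn [fnval]. rewrite hd_cp, tl_cp.
  destruct (Nat.ltb_spec (F x) (G x)); split; lia.
Qed.

Lemma definable_set_not P : definable_set P -> definable_set (fun x => ~ P x).
Proof.
  intros [p Hp].
  eapply definable_set_ext;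
    [|exact (definable_set_eq _ _ (definable_V p) (definable_const 0))].
  intro x. rewrite <- Hp. unfold mem. lia.
Qed.

Lemma definable_set_and P Q :
  definable_set P -> definable_set Q -> definable_set (fun x => P x /\ Q x).
Proof.
  intros [p Hp] [q Hq].
  eapply definable_set_ext;
    [|exact (definable_set_nonzero _
        (definable_times _ _ (definable_V p) (definable_V q)))].
  intro x. rewrite <- Hp, <- Hq. unfold mem. nia.
Qed.

Lemma definable_set_or P Q :
  definable_set P -> definable_set Q -> definable_set (fun x => P x \/ Q x).
Proof.
  intros [p Hp] [q Hq].
  eapply definable_set_ext;
    [|exact (definable_set_nonzero _
        (definable_plus _ _ (definable_V p) (definable_V q)))].
  intro x. rewrite <- Hp, <- Hq. unfold mem. lia.
Qed.

Lemma definable_set_imp P Q :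
  definable_set P -> definable_set Q -> definable_set (fun x => P x -> Q x).
Proof.
  intros HP HQ.
  eapply definable_set_ext;
    [|exact (definable_set_or _ _ (definable_set_not _ HP) HQ)].
  intro x. destruct (classic (P x)); tauto.
Qed.

(** [mu] is nonzero exactly when the search succeeds, so unbounded search absorbs a number
    quantifier. *)
Lemma definable_set_ex (P : nat -> nat -> Prop) :
  definable_set (fun z => P (hd z) (tl z)) ->
  definable_set (fun x => exists y, P y x).
Proof.
  intros [p Hp].
  eapply definable_set_ext;
    [|exact (definable_set_nonzero _ (definable_mu _ (definable_V p)))].
  intro x. cbv beta.
  assert (Hmu := mu_spec (fun y => V p (cp y x))).
  assert (H : forall y, P y x <-> V p (cp y x) <> 0).
  { intro y. fold (mem p (cp y x)). now rewrite Hp, hd_cp, tl_cp. }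
  destruct (mu _) as [|y]; split.
  - lia.
  - intros [y Hy]. apply H in Hy. now specialize (Hmu y).
  - intros _. exists y. apply H, Hmu.
  - lia.
Qed.

Lemma definable_set_all (P : nat -> nat -> Prop) :
  definable_set (fun z => P (hd z) (tl z)) ->
  definable_set (fun x => forall y, P y x).
Proof.
  intro H.
  eapply definable_set_ext; [|exact (definable_set_not _
    (definable_set_ex (fun y x => ~ P y x) (definable_set_not _ H)))].
  intro x. split.
  - intros Hn y. apply NNPP. intro Hy. apply Hn. now exists y.
  - intros Ha [y Hy]. auto.
Qed.

(** Packs the values of the [k] innermost number variables into the single argument of a definable
    predicate; [r] interprets the others. *)
Fixpoint prefixed (k x : nat) (r : nat -> nat) : nat -> nat :=
  match k with
  | 0 => r
  | S k => scons (hd x) (prefixed k (tl x) r)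
  end.

Lemma definable_term k r t : definable (fun x => teval (prefixed k x r) t).
Proof.
  induction t as [i| | |s IHs t IHt|s IHs t IHt]; simpl.
  - revert i. induction k as [|k IH]; intro i; simpl.
    + apply definable_const.
    + destruct i as [|i]; simpl; [apply definable_hd|].
      apply (definable_comp _ _ (IH i) definable_tl).
  - apply definable_const.
  - apply definable_const.
  - now apply definable_plus.
  - now apply definable_times.
Qed.

Lemma definable_arithmetical g p : arithmetical p -> forall k r,
  definable_set (fun x => sat mem (prefixed k x r) g p).
Proof.
  induction p as [|s t|s t|t X|p IHp q IHq|p IHp q IHq|p IHp q IHq
    |p IHp|p IHp|p IHp|p IHp]; cbn [arithmetical sat]; intros Ha k r.
  - eapply definable_set_ext; [|exact (definable_set_nonzero _ (definable_const 0))].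
    intro; simpl; tauto.
  - apply definable_set_eq; apply definable_term.
  - apply definable_set_lt; apply definable_term.
  - apply definable_set_preim; [now exists (g X)|]. apply definable_term.
  - apply definable_set_imp; [apply IHp|apply IHq]; apply Ha.
  - apply definable_set_and; [apply IHp|apply IHq]; apply Ha.
  - apply definable_set_or; [apply IHp|apply IHq]; apply Ha.
  - apply (definable_set_all (fun y x => sat mem (scons y (prefixed k x r)) g p)).
    apply (IHp Ha (S k) r).
  - apply (definable_set_ex (fun y x => sat mem (scons y (prefixed k x r)) g p)).
    apply (IHp Ha (S k) r).
  - contradiction.
  - contradiction.
Qed.

Lemma model_ACA0 p : ACA0 p -> forall r g, sat mem r g p.
Proof.
  destruct 1; intros r g; try (cbn; intros; lia).
  - cbn. intros X [H0 HS] n. induction n as [|n IH]; auto.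
    replace (S n) with (n + 1) by lia. auto.
  (* Only variable 0 is packed; the 0 in [cp x 0] fills the tail, which [prefixed 1] discards. *)
  - destruct (definable_set_preim _ (fun x => cp x 0)
      (definable_arithmetical g p H 1 r)) as [q Hq].
    + apply definable_cp; [apply definable_id | apply definable_const].
    + exists q. intro n. cbn [sat Iff teval scons].
      rewrite (sat_slift mem), (Hq n). cbn [prefixed]. rewrite hd_cp. tauto.
Qed.

(** * Reals of the model and paths through the tree *)

Lemma definable_graph F :
  definable F -> definable_set (fun z => exists i, pr i (F i) = z).
Proof.
  intro HF. apply (definable_set_ex (fun i z => pr i (F i) = z)).
  apply definable_set_eq; [apply definable_pr|].
  - apply definable_hd.
  - apply (definable_comp _ _ HF definable_hd).
  - apply definable_tl.
Qed.

Lemma graph_Real (F : nat -> nat) : Real (fun z => exists i, pr i (F i) = z).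
Proof.
  split; [|split].
  - intros z [i <-]. eauto.
  - eauto.
  - intros n m m' [[i Hi] [j Hj]].
    apply pr_inj in Hi as [-> <-], Hj as [-> <-]. reflexivity.
Qed.

Lemma Real_definable X : Real (mem X) ->
  exists p, forall n m, mem X (pr n m) -> V p n = m.
Proof.
  intros (_ & _ & Hfun).
  (* Search for the second coordinate; [pred] strips the success marker of [mu]. *)
  destruct (definable_pred _ (definable_mu (fun z => V X (pr (tl z) (hd z)))
    (definable_comp _ _ (definable_V X)
      (definable_pr _ _ definable_tl definable_hd)))) as [p Hp].
  exists p. intros n m Hm. rewrite Hp.
  assert (Hmu := mu_spec (fun y => V X (pr n y))).
  replace (fun y => V X _) with (fun y => V X (pr n y)).
  2:{ apply functional_extensionality. intro y. now rewrite hd_cp, tl_cp. }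
  destruct (mu _) as [|y].
  - now specialize (Hmu m).
  - apply (Hfun n). split; [apply Hmu | exact Hm].
Qed.

Definition pathfun (p : code) (i : nat) : nat :=
  match i with 0 => enc p | S j => trace skolem_tree p j end.

Lemma definable_pathfun p : definable (pathfun p).
Proof.
  eapply definable_ext; [|exact (definable_case _ _ _ definable_id
    (definable_const (enc p))
    (definable_comp _ _ (definable_trace p) (definable_pred _ definable_id)))].
  intros [|i]; reflexivity.
Qed.

Lemma pathfun_Path p : Path (fun z => exists i, pr i (pathfun p i) = z) skolem_tree.
Proof.
  split; [apply graph_Real|]. intros s [Hs H]. apply skolem_tree_fixpoint.
  assert (He : forall i v, Entry s i v -> v = pathfun p i).
  { intros i v Hv. destruct (H i v Hv) as [j Hj].
    apply pr_inj in Hj as [-> ->]. reflexivity. }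
  split; [exact Hs|]. intros k Hk. exists p.
  split; [now rewrite (He 0 k Hk)|].
  apply (consistent_anti skolem_tree p (fun i v => v = trace skolem_tree p i)).
  - intros i v. apply He.
  - apply consistent_trace.
Qed.

(** * Absence of perfect subtrees *)

(** If [t] had entries only at positions of [a], they would be entries of [a], hence of [u], making
    [t] an initial segment of [u]. *)
Lemma incompatible_longer a t u :
  InitSeg a t -> InitSeg a u -> Incompatible t u ->
  exists b i v, (b = t \/ b = u) /\ Entry b i v /\ forall w, ~ Entry a i w.
Proof.
  intros Hat Hau [Hn _]. apply NNPP; intro Hno. apply Hn.
  destruct Hat as (Ha & Ht & Hat), Hau as (_ & Hu & Hau).
  split; [exact Ht|split; [exact Hu|]]. intros i v Hv.
  apply Hau. apply NNPP; intro Hav. apply Hno.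
  exists t, i, v. repeat split; auto. intros w Hw. apply Hav.
  now rewrite (Entry_fun t i v w Hv (Hat i w Hw)).
Qed.

(** Perfectness allows climbing from [a] forever. The union of the nodes met is total and consistent
    with [p], so [consistent_unique] applies to it. *)
Lemma perfect_subtree_entries P p :
  Subtree P skolem_tree -> Perfect P ->
  forall a, P a -> Entry a 0 (enc p) ->
  forall i v, Entry a (S i) v -> v = trace skolem_tree p i.
Proof.
  intros [_ HPT] (_ & _ & HP) a Ha Ha0 i v Hv.
  (* [P b] is placed under the existential so that a successor can be chosen for every number at
     once. *)
  assert (Hnext : forall b, exists c, P b -> P c /\ InitSeg b c /\
            exists i v, Entry c i v /\ forall w, ~ Entry b i w).
  { intro b. destruct (classic (P b)) as [Hb|Hb]; [|exists 0; tauto].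
    destruct (HP b Hb) as (t & u & Ht & Hu & Hbt & Hbu & Hinc).
    destruct (incompatible_longer b t u Hbt Hbu Hinc) as (c & Hc).
    exists c. intros _. destruct Hc as (j & w & [->| ->] & Hc); eauto. }
  set (next b := epsilon (inhabits 0) (fun c => P b -> P c /\ InitSeg b c /\
            exists i v, Entry c i v /\ forall w, ~ Entry b i w)).
  assert (Hn : forall b, P b -> P (next b) /\ InitSeg b (next b) /\
            exists i v, Entry (next b) i v /\ forall w, ~ Entry b i w).
  { intro b. unfold next. apply epsilon_spec, Hnext. }
  clearbody next.
  set (c n := Nat.iter n next a).
  assert (HcP : forall n, P (c n)).
  { induction n as [|n IH]; [exact Ha|]. apply Hn, IH. }
  assert (Hmono : forall m n i v, m <= n -> Entry (c m) i v -> Entry (c n) i v).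
  { induction 1 as [|n Hmn IH]; auto. intro H.
    apply (Hn (c n) (HcP n)). auto. }
  (* A new entry at [j] forces [j] to be at least the old length, as all positions below that are
     filled; so the length grows at each step. *)
  assert (Hlen : forall n, exists l, n <= l /\ HasLength (c n) l).
  { induction n as [|n (l & Hl & Hlc)].
    - destruct (proj1 skolem_tree_is_tree _ (HPT _ (HcP 0))) as (l & Hl & _).
      exists l. split; [lia | exact Hl].
    - destruct (proj1 skolem_tree_is_tree _ (HPT _ (HcP (S n)))) as (l' & Hl' & _).
      exists l'. split; [|exact Hl'].
      destruct (Hn (c n) (HcP n)) as (_ & _ & j & w & Hj & Hnj).
      apply (Entry_length _ l') in Hj; [|exact Hl'].
      destruct (Nat.lt_ge_cases j l) as [Hjl|Hjl]; [|lia].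
      destruct (Entry_total _ _ _ Hlc Hjl) as [w' Hw']. now apply Hnj in Hw'. }
  apply (consistent_unique skolem_tree p (fun i v => exists n, Entry (c n) (S i) v)).
  - intro j. destruct (Hlen (S (S j))) as (l & Hl & Hlc).
    destruct (Entry_total _ _ (S j) Hlc) as [w Hw]; [lia|]. now exists w, (S (S j)).
  - apply (consistent_union skolem_tree p (fun n i => Entry (c n) (S i))).
    + intros m n j w Hmn. now apply Hmono.
    + intro n. destruct (proj1 (skolem_tree_fixpoint _) (HPT _ (HcP n))) as [_ H].
      destruct (H (enc p)) as (p' & Hp' & Hc).
      * apply (Hmono 0); [lia | exact Ha0].
      * now apply enc_inj in Hp' as ->.
  - now exists 0.
Qed.

Lemma no_perfect_subtree P : Subtree P skolem_tree -> ~ Perfect P.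
Proof.
  intros HS HP.
  assert (HPT : forall s, P s -> exists l, HasLength s l).
  { intros s Hs. destruct (proj1 skolem_tree_is_tree _ (proj2 HS _ Hs)) as (l & Hl & _).
    now exists l. }
  (* The given node may be the root, which names no term; one splitting above it yields a node with
     a first entry. *)
  assert (Hb : exists b p, P b /\ Entry b 0 (enc p)).
  { destruct (proj1 (proj2 HP)) as [s Hs].
    destruct (proj2 (proj2 HP) s Hs) as (t & u & Ht & Hu & Hst & Hsu & Hinc).
    destruct (incompatible_longer s t u Hst Hsu Hinc) as (b & i & v & Hb & Hv & _).
    assert (HPb : P b) by (destruct Hb as [->| ->]; assumption).
    destruct (HPT b HPb) as [l Hl].
    assert (Hi := Entry_length _ _ _ _ Hl Hv).
    destruct (Entry_total b l 0 Hl) as [k Hk]; [lia|].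
    destruct (proj1 (skolem_tree_fixpoint b) (proj2 HS b HPb)) as [_ H].
    destruct (H k Hk) as (p & <- & _). now exists b, p. }
  destruct Hb as (b & p & Hb & Hb0).
  destruct (proj2 (proj2 HP) b Hb) as (t & u & Ht & Hu & Hbt & Hbu & Hinc).
  assert (He : forall s, P s -> InitSeg b s ->
            forall i v, Entry s i v -> v = pathfun p i).
  { intros s Hs Hbs i v Hv. apply Hbs in Hb0. destruct i as [|i].
    - eapply Entry_fun; eauto.
    - now apply (perfect_subtree_entries P p HS HP s Hs Hb0). }
  destruct (HPT t Ht) as [l Hl], (HPT u Hu) as [l' Hl'].
  (* Nodes above [b] all follow [pathfun p], so the shorter of two is an initial segment of the
     longer. *)
  assert (Hsub : forall s s' l l', P s -> P s' -> InitSeg b s -> InitSeg b s' ->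
    HasLength s l -> HasLength s' l' -> l <= l' -> InitSeg s s').
  { intros s s' k k' Hs Hs' Hbs Hbs' Hk Hk' Hle.
    split; [apply Hbs|split; [apply Hbs'|]]. intros i v Hv.
    assert (Hi := Entry_length _ _ _ _ Hk Hv).
    destruct (Entry_total s' k' i Hk') as [w Hw]; [lia|].
    rewrite (He s Hs Hbs i v Hv), <- (He s' Hs' Hbs' i w Hw). exact Hw. }
  destruct Hinc as [H1 H2]. destruct (Nat.le_ge_cases l l').
  - apply H1. now apply (Hsub t u l l').
  - apply H2. now apply (Hsub u t l' l).
Qed.

(** * Cofinality *)

Definition seqcode (l : nat) (f : nat -> nat) : nat :=
  epsilon (inhabits 0) (fun s => Codes s l f).

Lemma seqcode_length l f : HasLength (seqcode l f) l.
Proof. apply (epsilon_spec _ _ (Codes_exists l f)). Qed.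

Lemma Entry_seqcode l f i v : Entry (seqcode l f) i v <-> i < l /\ v = f i.
Proof. apply (epsilon_spec _ _ (Codes_exists l f)). Qed.

Lemma Computes_intro e Y n m c d :
  Starts n c -> clos_refl_trans_1n nat (Step e Y) c d -> Halts e m d ->
  Computes e Y n m.
Proof.
  intros Hc Hcd Hd.
  assert (Hf : exists k f, f 0 = c /\ f k = d /\
            forall i, i < k -> Step e Y (f i) (f (S i))).
  { clear Hc Hd. induction Hcd as [c|c c' d Hs _ (k & f & H0 & Hk & H)].
    - exists 0, (fun _ => c). repeat split; auto. lia.
    - exists (S k), (scons c f). repeat split; auto.
      intros [|i] Hi; simpl; [now rewrite H0|]. apply H. lia. }
  destruct Hf as (k & f & <- & <- & H).
  exists (seqcode (k + 1) f), k. split; [apply seqcode_length|split; [|split]].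
  - exists (f 0). split; [|exact Hc]. apply Entry_seqcode. split; [lia|reflexivity].
  - intros i c d [H1 H2]. apply Entry_seqcode in H1 as [_ ->].
    apply Entry_seqcode in H2 as [Hi ->].
    replace (i + 1) with (S i) by lia. apply H. lia.
  - exists (f k). split; [|exact Hd]. apply Entry_seqcode. split; [lia|reflexivity].
Qed.

(** * A register machine for the reduction *)

Definition ins o j q := pr o (pr j q).

(** Computes [3 * n + 1] in register 0 and queries the oracle there;
    register 2 stays zero, so that decrementing it is an unconditional jump. *)
Definition instr (i : nat) : nat :=
  match i with
  | 0 => ins 1 0 5
  | 1 | 2 | 3 => ins 0 1 0
  | 4 => ins 1 2 0
  | 5 => ins 1 1 8
  | 6 => ins 0 0 0
  | 7 => ins 1 2 5
  | 8 => ins 0 0 0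
  | _ => ins 2 0 0
  end.

Definition prog : nat := seqcode 10 instr.

Definition regs (a b i : nat) : nat :=
  match i with 0 => a | 1 => b | _ => 0 end.

Definition conf (p a b : nat) : nat := pr p (seqcode 3 (regs a b)).

Lemma Step_conf Y p a b p' a' b' j q :
  j < 3 -> (forall i, i <> j -> regs a b i = regs a' b' i) ->
  (Entry prog p (ins 0 j q) /\ regs a' b' j = regs a b j + 1 /\ p' = p + 1 \/
   Entry prog p (ins 1 j q) /\ regs a b j = 0 /\ regs a' b' j = 0 /\ p' = q \/
   Entry prog p (ins 1 j q) /\ regs a b j = regs a' b' j + 1 /\ p' = p + 1 \/
   Entry prog p (ins 2 j q) /\ Y (pr (regs a b j) (regs a' b' j)) /\ p' = p + 1) ->
  Step prog Y (conf p a b) (conf p' a' b').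
Proof.
  intros Hj Hi H.
  exists p, (seqcode 3 (regs a b)), p', (seqcode 3 (regs a' b')), j, q,
    (regs a b j), (regs a' b' j).
  do 2 (split; [reflexivity|]).
  do 2 (split; [now apply Entry_seqcode|]).
  split; [|exact H].
  intros i u Hij. now rewrite !Entry_seqcode, Hi.
Qed.

Lemma Entry_prog p v : p < 10 -> Entry prog p v <-> v = instr p.
Proof. intro Hp. unfold prog. rewrite Entry_seqcode. tauto. Qed.

Section Program.
Variable Y : nat -> Prop.

Notation steps := (clos_refl_trans_1n nat (Step prog Y)).

Lemma steps_trans c d e : steps c d -> steps d e -> steps c e.
Proof.
  intros H1 H2. apply clos_rt_rt1n.
  apply rt_trans with d; now apply clos_rt1n_rt.
Qed.

Lemma steps_cons d c e : Step prog Y c d -> steps d e -> steps c e.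
Proof. intros H1 H2. exact (Relation_Operators.rt1n_trans _ _ _ _ _ H1 H2). Qed.

(** [j] and [q] are the register and the last component of the instruction being executed. *)
Ltac run j q :=
  apply Step_conf with j q;
  [ lia
  | intros [|[|[|?]]]; simpl; lia
  | rewrite !Entry_prog by lia; simpl; intuition lia ].

(** Instructions 0 to 4 form a loop that takes one from register 0 and adds three to register 1, the
    accumulator over which the induction generalises. *)
Lemma run_triple a : forall b, steps (conf 0 a b) (conf 5 0 (3 * a + b)).
Proof.
  induction a as [|a IH]; intro b.
  - apply steps_cons with (conf 5 0 b); [run 0 5 | apply rt1n_refl].
  - apply steps_cons with (conf 1 a b); [run 0 5|].
    apply steps_cons with (conf 2 a (b + 1)); [run 1 0|].
    apply steps_cons with (conf 3 a (b + 2)); [run 1 0|].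
    apply steps_cons with (conf 4 a (b + 3)); [run 1 0|].
    apply steps_cons with (conf 0 a (b + 3)); [run 2 0|].
    replace (3 * S a + b) with (3 * a + (b + 3)) by lia. apply IH.
Qed.

(** The loop 5 to 7 moves register 1 back to register 0, where the oracle will be queried. *)
Lemma run_move b : forall a, steps (conf 5 a b) (conf 8 (a + b) 0).
Proof.
  induction b as [|b IH]; intro a.
  - rewrite Nat.add_0_r.
    apply steps_cons with (conf 8 a 0); [run 1 8 | apply rt1n_refl].
  - apply steps_cons with (conf 6 a b); [run 1 8|].
    apply steps_cons with (conf 7 (a + 1) b); [run 0 0|].
    apply steps_cons with (conf 5 (a + 1) b); [run 2 5|].
    replace (a + S b) with (a + 1 + b) by lia. apply IH.
Qed.

Lemma prog_computes n m : Y (pr (3 * n + 1) m) -> Computes prog Y n m.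
Proof.
  intro HY. apply Computes_intro with (conf 0 n 0) (conf 10 m 0).
  - exists (seqcode 3 (regs n 0)). split; [reflexivity|split].
    + apply Entry_seqcode. split; [lia | reflexivity].
    + intros i v Hv. apply Entry_seqcode in Hv as [_ ->].
      rewrite Nat.add_1_r. now destruct i.
  - eapply steps_trans; [apply run_triple|].
    eapply steps_trans; [apply run_move|].
    apply steps_cons with (conf 9 (3 * n + 1) 0); [run 0 0|].
    apply steps_cons with (conf 10 m 0); [run 0 0 | apply rt1n_refl].
  - exists 10, (seqcode 3 (regs m 0)). split; [reflexivity|split].
    + intros [j Hj]. apply Entry_seqcode in Hj. lia.
    + apply Entry_seqcode. split; [lia | reflexivity].
Qed.

End Program.

(** If [V p] is the real, its value at [n] stands at position [3 * n] of the trace of [p], hence at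
    position [3 * n + 1] of the path. One program therefore works for all reals. *)
Lemma paths_cofinal_skolem_tree X : Real (mem X) ->
  exists Y, Path (mem Y) skolem_tree /\ TuringReducible (mem X) (mem Y).
Proof.
  intro HX. destruct (Real_definable X HX) as [p Hp].
  destruct (definable_graph _ (definable_pathfun p)) as [Y HY].
  assert (Heq : mem Y = fun z => exists i, pr i (pathfun p i) = z).
  { apply functional_extensionality. intro z.
    apply propositional_extensionality, HY. }
  exists Y. rewrite Heq. split; [apply pathfun_Path|].
  exists prog. intros n m Hm. apply prog_computes.
  exists (3 * n + 1). f_equal. rewrite Nat.add_1_r. cbn [pathfun].
  rewrite trace_0. now apply Hp.
Qed.

Theorem proposition3p4 : ~ proves ACA0 wMPT.
Proof.
  intro H.
  assert (Hs := soundness mem ACA0 model_ACA0 nil wMPT H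
    (fun _ => 0) (fun _ => CFn FTree)).
  rewrite sat_wMPT in Hs.
  (* The base function [FTree] makes the tree a set of the model. *)
  assert (Heq : mem (CFn FTree) = skolem_tree).
  { apply functional_extensionality. intro s.
    apply propositional_extensionality, chi_spec. }
  destruct (Hs (fun _ H => match H with end) (CFn FTree)) as (P & HP & HP').
  - rewrite Heq. split; [apply skolem_tree_is_tree | exact paths_cofinal_skolem_tree].
  - rewrite Heq in HP. now apply (no_perfect_subtree (mem P)).
Qed.
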